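(* Let $\underline{C}$ be a $G$-coalgebra. The following assertions are equivalent: (1) $\underline{C}$ is a strong $G$-coalgebra; (2) $(F,\mathsf{G})$ is a pair of inverse equivalences between $\mathcal{M}^{G,\underline{C}}$ and $\mathcal{M}^{C_e}$; (3) $\Delta_{\alpha,\beta}$ corestricts to an isomorphism $C_{\alpha\beta}\to C_\alpha\square_{C_e}C_\beta$, for all $\alpha,\beta\in G$.
   Context: $k$ is a field, $\otimes=\otimes_k$, $G$ is a group with identity $e$; the identity map of an object $X$ is denoted $X$. A $G$-coalgebra (group coalgebra) $\underline{C}=(C_\alpha)_{\alpha\in G}$ is a family of $k$-vector spaces with $k$-linear maps $\Delta_{\alpha,\beta}:C_{\alpha\beta}\to C_\alpha\otimes C_\beta$ ($\alpha,\beta\in G$) and $\varepsilon:C_e\to k$ such that $(\Delta_{\alpha,\beta}\otimes C_\gamma)\circ\Delta_{\alpha\beta,\gamma}=(C_\alpha\otimes\Delta_{\beta,\gamma})\circ\Delta_{\alpha,\beta\gamma}$ and $(C_\alpha\otimes\varepsilon)\circ\Delta_{\alpha,e}=C_\alpha=(\varepsilon\otimes C_\alpha)\circ\Delta_{e,\alpha}$. Then $C_e$ is a coalgebra, and each $C_\alpha$ is a $C_e$-bicomodule via $\Delta_{e,\alpha}$ and $\Delta_{\alpha,e}$. $\underline{C}$ is called strong if $\Delta_{\alpha,\beta}$ is a monomorphism for all $\alpha,\beta\in G$. A right $G$-$\underline{C}$-comodule is a family $\underline{M}=(M_\alpha)_{\alpha\in G}$ of $k$-vector spaces with $k$-linear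 maps $\rho_{\alpha,\beta}:M_{\alpha\beta}\to M_\alpha\otimes C_\beta$ such that $(M_\alpha\otimes\varepsilon)\circ\rho_{\alpha,e}=M_\alpha$ and $(\rho_{\alpha,\beta}\otimes C_\gamma)\circ\rho_{\alpha\beta,\gamma}=(M_\alpha\otimes\Delta_{\beta,\gamma})\circ\rho_{\alpha,\beta\gamma}$. Morphisms $\underline{M}\to\underline{N}$ are families of $k$-linear maps $\varphi_\alpha:M_\alpha\to N_\alpha$ with $(\varphi_\alpha\otimes C_\beta)\circ\rho^{\underline{M}}_{\alpha,\beta}=\rho^{\underline{N}}_{\alpha,\beta}\circ\varphi_{\alpha\beta}$. This category is $\mathcal{M}^{G,\underline{C}}$. $\mathcal{M}^{C_e}$ is the category of right $C_e$-comodules. $(F,\mathsf{G})$ is the following adjoint pair. $F:\mathcal{M}^{G,\underline{C}}\to\mathcal{M}^{C_e}$, $F(\underline{M})=M_e$ with coaction $\rho_{e,e}$. $\mathsf{G}:\mathcal{M}^{C_e}\to\mathcal{M}^{G,\underline{C}}$, $\mathsf{G}(N)_\alpha=N\square_{C_e}C_\alpha$ (cotensor product over $C_e$), with structure maps $N\square_{C_e}\Delta_{\alpha,\beta}:N\square_{C_e}C_{\alpha\beta}\to N\square_{C_e}(C_\alpha\otimes C_\beta)\cong(N\square_{C_e}C_\alpha)\otimes C_\beta$. The unit has components $M_\alpha\to M_e\square_{C_e}C_\alpha$, the corestriction of $\rho_{e,\alpha}$, and the counit is $N\square_{C_e}C_e\to N$, $\sum_i n_i\otimes c_i\mapsto\sum_i\varepsilon(c_i)n_i$.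 (The paper denotes the functor $\mathsf{G}$ by $G$.) *)

(* Defs.v *)
From HB Require Import structures.
From mathcomp Require Import all_boot all_algebra.
From mathcomp Require Import boolp classical_sets.

Set Implicit Arguments.
Unset Strict Implicit.
Unset Printing Implicit Defensive.

Import GRing.Theory.
Local Open Scope quotient_scope.
Local Open Scope ring_scope.

(* Finite formal sums of pairs [(u1, v1); ...; (un, vn)], standing for
   u1 (x) v1 + ... + un (x) vn, modulo the relations of the tensor product. *)
Inductive tensor_eqv (k : fieldType) (U V : lmodType k) :
    seq (U * V) -> seq (U * V) -> Prop :=
| teqv_refl s : tensor_eqv s s
| teqv_sym s t : tensor_eqv s t -> tensor_eqv t s
| teqv_trans s t r : tensor_eqv s t -> tensor_eqv t r -> tensor_eqv s r
| teqv_cat s1 t1 s2 t2 :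
    tensor_eqv s1 t1 -> tensor_eqv s2 t2 -> tensor_eqv (s1 ++ s2) (t1 ++ t2)
| teqv_catC s t : tensor_eqv (s ++ t) (t ++ s)
| teqv_zero v : tensor_eqv [:: (0, v)] [::]
| teqv_addl u1 u2 v : tensor_eqv [:: (u1 + u2, v)] [:: (u1, v); (u2, v)]
| teqv_addr u v1 v2 : tensor_eqv [:: (u, v1 + v2)] [:: (u, v1); (u, v2)]
| teqv_scale a u v : tensor_eqv [:: (a *: u, v)] [:: (u, a *: v)].

Section Tensor.
Variables (k : fieldType) (U V : lmodType k).

Definition teqvb (s t : seq (U * V)) : bool := `[< tensor_eqv s t >].

Lemma teqvb_equiv : equiv_class_of teqvb.
Proof.
split=> [s|s t|t s r].
- exact/asboolP/teqv_refl.
- by apply/asboolP/asboolP; exact: teqv_sym.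
- by move=> /asboolP st /asboolP tr; apply/asboolP; exact: teqv_trans st tr.
Qed.

Canonical teqvb_equivRel := EquivRelPack teqvb_equiv.
Canonical teqvb_encModRel := defaultEncModRel teqvb.

Definition tensor := {eq_quot teqvb}.
HB.instance Definition _ := EqQuotient.on tensor.
HB.instance Definition _ := Choice.on tensor.

Implicit Types (s t : seq (U * V)) (x y z : tensor).

Definition tpi s : tensor := \pi s.

Lemma tpi_eqP s t : tensor_eqv s t <-> tpi s = tpi t.
Proof.
split=> [st|/eqmodP /asboolP //].
by apply/eqmodP/asboolP.
Qed.

Lemma tpi_eq s t : tensor_eqv s t -> tpi s = tpi t.
Proof. by move/tpi_eqP. Qed.

Lemma repr_eqv s : tensor_eqv (repr (tpi s)) s.
Proof. by apply/tpi_eqP; rewrite /tpi reprK. Qed.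

Lemma tensorW (P : tensor -> Prop) : (forall s, P (tpi s)) -> forall x, P x.
Proof. by move=> Ps x; rewrite -[x]reprK; exact: Ps. Qed.

Definition tscale_seq (a : k) s := [seq (a *: p.1, p.2) | p <- s].

Definition tadd x y : tensor := tpi (repr x ++ repr y).
Definition tzero : tensor := tpi [::].
Definition tscale (a : k) x : tensor := tpi (tscale_seq a (repr x)).
Definition topp x : tensor := tscale (-1) x.

Lemma tscale_seq_eqv a s t :
  tensor_eqv s t -> tensor_eqv (tscale_seq a s) (tscale_seq a t).
Proof.
elim=> {s t} //=.
- by move=> s; exact: teqv_refl.
- by move=> s t _; exact: teqv_sym.
- by move=> s t r _ st _; exact: teqv_trans.
- by move=> s1 t1 s2 t2 _ h1 _ h2; rewrite /tscale_seq !map_cat; exact: teqv_cat.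
- by move=> s t; rewrite /tscale_seq !map_cat; exact: teqv_catC.
- by move=> v; rewrite scaler0; exact: teqv_zero.
- by move=> u1 u2 v; rewrite scalerDr; exact: teqv_addl.
- by move=> u v1 v2; exact: teqv_addr.
- by move=> b u v; rewrite scalerA mulrC -scalerA; exact: teqv_scale.
Qed.

Lemma tpiD s t : tadd (tpi s) (tpi t) = tpi (s ++ t).
Proof. by apply/tpi_eqP/teqv_cat; exact: repr_eqv. Qed.

Lemma tpiZ a s : tscale a (tpi s) = tpi (tscale_seq a s).
Proof. by apply/tpi_eqP/tscale_seq_eqv; exact: repr_eqv. Qed.

Lemma taddA : associative tadd.
Proof.
elim/tensorW => s; elim/tensorW => t; elim/tensorW => r.
by rewrite !tpiD catA.
Qed.

Lemma taddC : commutative tadd.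
Proof.
elim/tensorW => s; elim/tensorW => t; rewrite !tpiD.
exact/tpi_eqP/teqv_catC.
Qed.

Lemma tadd0 : left_id tzero tadd.
Proof. by elim/tensorW => s; rewrite tpiD. Qed.

Lemma tscaleDl x a b : tscale (a + b) x = tadd (tscale a x) (tscale b x).
Proof.
elim/tensorW: x => s; rewrite !tpiZ; elim: s => [|[u v] s IH] /=.
  by rewrite tadd0.
rewrite -cat1s -tpiD {}IH scalerDl.
rewrite (tpi_eq (teqv_addl _ _ _)).
rewrite -[_ :: tscale_seq a s]cat1s -[_ :: tscale_seq b s]cat1s.
rewrite -[[:: (_, v); _]]cat1s -!tpiD -!taddA; congr tadd.
by rewrite taddC -taddA; congr tadd; rewrite taddC.
Qed.

Lemma tscale1 : left_id 1 tscale.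
Proof.
elim/tensorW => s; rewrite tpiZ; congr tpi.
by elim: s => [|[u v] s /= ->] //; rewrite scale1r.
Qed.

Lemma tscale0 x : tscale 0 x = tzero.
Proof.
elim/tensorW: x => s; rewrite tpiZ; elim: s => [|[u v] s IH] //=.
by rewrite -cat1s -tpiD {}IH scale0r (tpi_eq (teqv_zero _ _)) tadd0.
Qed.

Lemma taddN : left_inverse tzero topp tadd.
Proof.
by move=> x; rewrite -[X in tadd _ X]tscale1 -tscaleDl addNr tscale0.
Qed.

HB.instance Definition _ :=
  GRing.isZmodule.Build tensor taddA taddC tadd0 taddN.

Lemma tscaleA a b x : tscale a (tscale b x) = tscale (a * b) x.
Proof.
elim/tensorW: x => s; rewrite !tpiZ /tscale_seq -map_comp; congr tpi.
by apply: eq_map => -[u v] /=; rewrite scalerA.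
Qed.

Lemma tscaleDr : right_distributive tscale +%R.
Proof.
move=> a; elim/tensorW => s; elim/tensorW => t.
by rewrite [tpi s + tpi t]tpiD !tpiZ /tscale_seq map_cat -tpiD.
Qed.

HB.instance Definition _ := GRing.Zmodule_isLmodule.Build k tensor
  tscaleA tscale1 tscaleDr tscaleDl.

Definition tens (u : U) (v : V) : tensor := tpi [:: (u, v)].

Lemma tens_is_bilinear : bilinear_for *:%R *:%R tens.
Proof.
split=> [v a u1 u2|u a v1 v2] /=.
  rewrite [a *: tens _ _]tpiZ [RHS]tpiD /=.
  exact/tpi_eq/teqv_addl.
rewrite [a *: tens _ _]tpiZ [RHS]tpiD /= /tens (tpi_eq (teqv_addr _ _ _)).
rewrite -[[:: (u, _); _]]cat1s -[[:: (_ *: u, _); _]]cat1s -!tpiD.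
by congr tadd; apply/tpi_eq/teqv_sym/teqv_scale.
Qed.

HB.instance Definition _ :=
  bilinear_isBilinear.Build k U V tensor *:%R *:%R tens tens_is_bilinear.

Lemma tens0l v : tens 0 v = 0. Proof. exact: linear0l. Qed.
Lemma tens0r u : tens u 0 = 0. Proof. exact: linear0r. Qed.
Lemma tensDl u1 u2 v : tens (u1 + u2) v = tens u1 v + tens u2 v.
Proof. exact: linearDl. Qed.
Lemma tensDr u v1 v2 : tens u (v1 + v2) = tens u v1 + tens u v2.
Proof. exact: linearDr. Qed.
Lemma tensZl a u v : tens (a *: u) v = a *: tens u v.
Proof. exact: linearZl_LR. Qed.
Lemma tensZr a u v : tens u (a *: v) = a *: tens u v.
Proof. exact: linearZr_LR. Qed.

Lemma tpiE s : tpi s = \sum_(p <- s) tens p.1 p.2.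
Proof.
elim: s => [|[u v] s IH]; first by rewrite big_nil.
by rewrite big_cons -IH -cat1s -tpiD.
Qed.

Lemma tensor_ind (P : tensor -> Prop) :
  P 0 -> (forall x y, P x -> P y -> P (x + y)) ->
  (forall u v, P (tens u v)) -> forall x, P x.
Proof.
move=> P0 PD Pt; elim/tensorW => s; rewrite tpiE.
by elim/big_ind: _ => //.
Qed.

End Tensor.

Notation "U ⊗ V" := (tensor U V) (at level 40, left associativity) : ring_scope.

Section TensorLift.
Variables (k : fieldType) (U V W : lmodType k).

Lemma tensor_linear_ext (f g : {linear U ⊗ V -> W}) :
  (forall u v, f (tens u v) = g (tens u v)) -> f =1 g.
Proof.
move=> fg; elim/tensor_ind => [|x y fx fy|//]; first by rewrite !linear0.
by rewrite !linearD fx fy.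
Qed.

Variable b : {bilinear U -> V -> W}.

Definition tlift (x : U ⊗ V) : W := \sum_(p <- repr x) b p.1 p.2.

Lemma tlift_pi s : tlift (tpi s) = \sum_(p <- s) b p.1 p.2.
Proof.
rewrite /tlift; move: (repr (tpi s)) (repr_eqv s) => t.
elim=> {s t} //=.
- by move=> s t r _ -> _ ->.
- by move=> s1 t1 s2 t2 _ h1 _ h2; rewrite !big_cat h1 h2.
- by move=> s t; rewrite !big_cat /= addrC.
- by move=> v; rewrite big_seq1 big_nil linear0l.
- by move=> u1 u2 v; rewrite !big_cons !big_nil !addr0 linearDl.
- by move=> u v1 v2; rewrite !big_cons !big_nil !addr0 linearDr.
- by move=> a u v; rewrite !big_seq1 linearZl_LR linearZr_LR.
Qed.

Lemma tlift_is_linear : linear tlift.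
Proof.
move=> a; elim/tensorW => s; elim/tensorW => t.
rewrite [a *: _]tpiZ [_ + _]tpiD !tlift_pi big_cat big_map /=; congr (_ + _).
by rewrite scaler_sumr; apply: eq_bigr => p _; rewrite linearZl_LR.
Qed.

HB.instance Definition _ := GRing.isLinear.Build k (U ⊗ V) W *:%R tlift
  tlift_is_linear.

Lemma tliftE u v : tlift (tens u v) = b u v.
Proof. by rewrite tlift_pi big_seq1. Qed.

End TensorLift.

Lemma linear_eqP (k : fieldType) (U V : lmodType k) (f g : {linear U -> V}) :
  f =1 g -> f = g.
Proof.
case: f g => [f [[[f1 f2]] [f3]]] [g [[[g1 g2]] [g3]]] /= /funext fg.
rewrite {}fg in f1 f2 f3 *.
by rewrite (Prop_irrelevance f1 g1) (Prop_irrelevance f2 g2)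
           (Prop_irrelevance f3 g3).
Qed.

Section LinearInverse.
Variables (k : fieldType) (U V : lmodType k) (f : {linear U -> V}).
Hypothesis fbij : bijective f.

Lemma bij_surj y : exists x, f x == y.
Proof. by have [g _ gK] := fbij; exists (g y); rewrite gK. Qed.

Definition linv (y : V) : U := xchoose (bij_surj y).

Lemma linvK : cancel linv f.
Proof. by move=> y; apply/eqP/(xchooseP (bij_surj y)). Qed.

Lemma linvKV : cancel f linv.
Proof. by move=> x; apply: (bij_inj fbij); rewrite linvK. Qed.

Lemma linv_is_linear : linear linv.
Proof.
by move=> a x y; apply: (bij_inj fbij); rewrite linearP !linvK.
Qed.

HB.instance Definition _ := GRing.isLinear.Build k V U *:%R linv linv_is_linear.

End LinearInverse.

Section TensorMap.
Variables (k : fieldType) (U U' V V' : lmodType k).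
Variables (f : {linear U -> U'}) (g : {linear V -> V'}).

Definition tmap_pure (u : U) (v : V) : U' ⊗ V' := tens (f u) (g v).

Lemma tmap_pure_is_bilinear : bilinear_for *:%R *:%R tmap_pure.
Proof.
split=> [v a u1 u2|u a v1 v2] /=; rewrite /tmap_pure.
  by rewrite linearP linearPl.
by rewrite linearP linearPr.
Qed.

HB.instance Definition _ := bilinear_isBilinear.Build k U V (U' ⊗ V')
  *:%R *:%R tmap_pure tmap_pure_is_bilinear.

Definition tmap : U ⊗ V -> U' ⊗ V' := tlift tmap_pure.
HB.instance Definition _ := GRing.Linear.on tmap.

Lemma tmapE u v : tmap (tens u v) = tens (f u) (g v).
Proof. exact: tliftE. Qed.

End TensorMap.
Arguments tmap : simpl never.

Lemma tensor_linear_ext3 (k : fieldType) (U V W X : lmodType k)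
    (f g : {linear (U ⊗ V) ⊗ W -> X}) :
  (forall u v w, f (tens (tens u v) w) = g (tens (tens u v) w)) -> f =1 g.
Proof.
move=> fg; apply: tensor_linear_ext => x w.
elim/tensor_ind: x => [|x y fx fy|//]; first by rewrite linear0l !linear0.
by rewrite linearDl !linearD fx fy.
Qed.

Lemma tensor_linear_ext3r (k : fieldType) (U V W X : lmodType k)
    (f g : {linear U ⊗ (V ⊗ W) -> X}) :
  (forall u v w, f (tens u (tens v w)) = g (tens u (tens v w))) -> f =1 g.
Proof.
move=> fg; apply: tensor_linear_ext => u x.
elim/tensor_ind: x => [|x y fx fy|//]; first by rewrite linear0r !linear0.
by rewrite linearDr !linearD fx fy.
Qed.

Section TensorMapTheory.
Variable k : fieldType.
Implicit Types U V W : lmodType k.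

Lemma tmap_id U V : tmap (idfun : {linear U -> U}) (idfun : {linear V -> V}) =1 id.
Proof. by apply: (@tensor_linear_ext _ _ _ _ _ idfun) => u v; rewrite /= tmapE. Qed.

Lemma tmap_comp U U' U'' V V' V'' (f' : {linear U' -> U''})
    (f : {linear U -> U'}) (g' : {linear V' -> V''}) (g : {linear V -> V'}) x :
  tmap f' g' (tmap f g x) = tmap (f' \o f) (g' \o g) x.
Proof.
move: x; apply: (@tensor_linear_ext _ _ _ _ (tmap f' g' \o tmap f g)) => u v.
by rewrite /= !tmapE.
Qed.

Lemma eq_tmap U U' V V' (f f' : {linear U -> U'}) (g g' : {linear V -> V'}) :
  f =1 f' -> g =1 g' -> tmap f g =1 tmap f' g'.
Proof. by move=> /linear_eqP -> /linear_eqP ->. Qed.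

End TensorMapTheory.

Section TensorAssoc.
Variables (k : fieldType) (U V W : lmodType k).

Definition tassoc_pure (w : W) (u : U) (v : V) : U ⊗ (V ⊗ W) :=
  tens u (tens v w).

Lemma tassoc_pure_is_bilinear w : bilinear_for *:%R *:%R (tassoc_pure w).
Proof.
split=> [v a u1 u2|u a v1 v2] /=; rewrite /tassoc_pure.
  by rewrite linearPl.
by rewrite linearPl linearPr.
Qed.

HB.instance Definition _ w := bilinear_isBilinear.Build k U V (U ⊗ (V ⊗ W))
  *:%R *:%R (tassoc_pure w) (tassoc_pure_is_bilinear w).

Definition tassoc_fun (x : U ⊗ V) (w : W) := tlift (tassoc_pure w) x.

Lemma tassoc_fun_is_bilinear : bilinear_for *:%R *:%R tassoc_fun.
Proof.
split=> [w a x y|x a w1 w2] /=; rewrite /tassoc_fun; first by rewrite linearP.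
elim/tensor_ind: x => [|x y IHx IHy|u v].
- by rewrite !linear0 addr0.
- by rewrite !(linearD (tlift _)) /= IHx IHy scalerDr addrACA.
- by rewrite !tliftE /= /tassoc_pure !linearPr.
Qed.

HB.instance Definition _ := bilinear_isBilinear.Build k (U ⊗ V) W (U ⊗ (V ⊗ W))
  *:%R *:%R tassoc_fun tassoc_fun_is_bilinear.

Definition tassoc : (U ⊗ V) ⊗ W -> U ⊗ (V ⊗ W) := tlift tassoc_fun.
HB.instance Definition _ := GRing.Linear.on tassoc.

Lemma tassocE u v w : tassoc (tens (tens u v) w) = tens u (tens v w).
Proof. by rewrite [LHS]tliftE [LHS]tliftE. Qed.

Definition tassocV_pure (u : U) (v : V) (w : W) : (U ⊗ V) ⊗ W :=
  tens (tens u v) w.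

Lemma tassocV_pure_is_bilinear u : bilinear_for *:%R *:%R (tassocV_pure u).
Proof.
split=> [v a u1 u2|u' a v1 v2] /=; rewrite /tassocV_pure.
  by rewrite linearPr linearPl.
by rewrite linearPr.
Qed.

HB.instance Definition _ u := bilinear_isBilinear.Build k V W ((U ⊗ V) ⊗ W)
  *:%R *:%R (tassocV_pure u) (tassocV_pure_is_bilinear u).

Definition tassocV_fun (u : U) (x : V ⊗ W) := tlift (tassocV_pure u) x.

Lemma tassocV_fun_is_bilinear : bilinear_for *:%R *:%R tassocV_fun.
Proof.
split=> [x a u1 u2|u a x y] /=; rewrite /tassocV_fun; last by rewrite linearP.
elim/tensor_ind: x => [|x y IHx IHy|v w].
- by rewrite !linear0 addr0.
- by rewrite !(linearD (tlift _)) /= IHx IHy scalerDr addrACA.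
- by rewrite !tliftE /= /tassocV_pure !linearPl.
Qed.

HB.instance Definition _ := bilinear_isBilinear.Build k U (V ⊗ W) ((U ⊗ V) ⊗ W)
  *:%R *:%R tassocV_fun tassocV_fun_is_bilinear.

Definition tassocV : U ⊗ (V ⊗ W) -> (U ⊗ V) ⊗ W := tlift tassocV_fun.
HB.instance Definition _ := GRing.Linear.on tassocV.

Lemma tassocVE u v w : tassocV (tens u (tens v w)) = tens (tens u v) w.
Proof. by rewrite [LHS]tliftE [LHS]tliftE. Qed.

Lemma tassocK : cancel tassoc tassocV.
Proof.
apply: (@tensor_linear_ext3 _ _ _ _ _ (tassocV \o tassoc) idfun) => u v w.
by rewrite /= tassocE tassocVE.
Qed.

Lemma tassocVK : cancel tassocV tassoc.
Proof.
apply: (@tensor_linear_ext3r _ _ _ _ _ (tassoc \o tassocV) idfun) => u v w.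
by rewrite /= tassocVE tassocE.
Qed.

End TensorAssoc.
Arguments tassoc {k U V W} : simpl never.
Arguments tassocV {k U V W} : simpl never.

Section TensorUnit.
Variables (k : fieldType) (U : lmodType k).

Definition tunitr_fun (u : U) (a : k^o) : U := a *: u.
Definition tunitl_fun (a : k^o) (u : U) : U := a *: u.

Lemma tunitl_fun_is_bilinear : bilinear_for *:%R *:%R tunitl_fun.
Proof.
split=> [u c a b|b c u v] /=; rewrite /tunitl_fun.
  by rewrite scalerDl -scalerA.
by rewrite scalerDr !scalerA mulrC.
Qed.

Lemma tunitr_fun_is_bilinear : bilinear_for *:%R *:%R tunitr_fun.
Proof. by case: tunitl_fun_is_bilinear => h1 h2; split=> x; [exact: h2|exact: h1]. Qed.

HB.instance Definition _ := bilinear_isBilinear.Build k k^o U U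
  *:%R *:%R tunitl_fun tunitl_fun_is_bilinear.
HB.instance Definition _ := bilinear_isBilinear.Build k U k^o U
  *:%R *:%R tunitr_fun tunitr_fun_is_bilinear.

(* The canonical isomorphisms U ⊗ k -> U and k ⊗ U -> U. *)
Definition tunitr : U ⊗ k^o -> U := tlift tunitr_fun.
HB.instance Definition _ := GRing.Linear.on tunitr.
Definition tunitl : k^o ⊗ U -> U := tlift tunitl_fun.
HB.instance Definition _ := GRing.Linear.on tunitl.

Lemma tunitrE u a : tunitr (tens u a) = a *: u.
Proof. exact: tliftE. Qed.
Lemma tunitlE a u : tunitl (tens a u) = a *: u.
Proof. exact: tliftE. Qed.

End TensorUnit.
Arguments tunitr {k U} : simpl never.
Arguments tunitl {k U} : simpl never.

Section Equalizer.
Variables (k : fieldType) (U V : lmodType k) (f g : {linear U -> V}).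

Definition eqz_pred : {pred U} := fun x => f x == g x.

Lemma eqz_pred_submod : subsemimod_closed eqz_pred.
Proof.
split; first split.
- by rewrite unfold_in !linear0.
- by move=> x y; rewrite !unfold_in !linearD => /eqP -> /eqP ->.
- by move=> a x; rewrite !unfold_in !linearZ_LR => /eqP ->.
Qed.

HB.instance Definition _ := GRing.isSubmodClosed.Build k U eqz_pred
  eqz_pred_submod.

Record equalizer : Type := Equalizer {
  eqz_val : U;
  eqz_valP : eqz_val \in eqz_pred }.

HB.instance Definition _ := [isSub for eqz_val].
HB.instance Definition _ := [Choice of equalizer by <:].
HB.instance Definition _ := [SubChoice_isSubLmodule of equalizer by <:].

Lemma eqz_val_is_linear : linear eqz_val.
Proof. by []. Qed.
HB.instance Definition _ := GRing.isLinear.Build k equalizer U *:%R eqz_val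
  eqz_val_is_linear.

Lemma eqzP (x : equalizer) : f (eqz_val x) = g (eqz_val x).
Proof. exact/eqP/(eqz_valP x). Qed.

Lemma eqz_val_inj : injective eqz_val.
Proof. exact: val_inj. Qed.

Section Corestriction.
Variables (X : lmodType k) (h : {linear X -> U}).
Hypothesis fgh : forall x, f (h x) = g (h x).

Lemma eqz_corestr_subproof x : h x \in eqz_pred.
Proof. by rewrite unfold_in; apply/eqP/fgh. Qed.

Definition eqz_corestr (x : X) : equalizer := Equalizer (eqz_corestr_subproof x).

Lemma eqz_corestr_is_linear : linear eqz_corestr.
Proof. by move=> a x y; apply: eqz_val_inj; rewrite !linearP /= linearP. Qed.

HB.instance Definition _ := GRing.isLinear.Build k X equalizer *:%R eqz_corestr
  eqz_corestr_is_linear.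

End Corestriction.
End Equalizer.
Arguments eqz_val {k U V f g}.


Section GeneralizedInverse.
Variable k : fieldType.
Local Open Scope classical_set_scope.

Definition is_subspace (U : lmodType k) (S : set U) :=
  S 0 /\ forall a x y, S x -> S y -> S (a *: x + y).

Lemma is_subspaceB (U : lmodType k) (S : set U) x y :
  is_subspace S -> S x -> S y -> S (x - y).
Proof. by move=> [_ cl] Sx Sy; rewrite addrC -scaleN1r; exact: cl. Qed.

Lemma is_subspaceZ (U : lmodType k) (S : set U) a x :
  is_subspace S -> S x -> S (a *: x).
Proof. by move=> [S0 cl] Sx; rewrite -[_ *: _]addr0; exact: cl. Qed.

Lemma complement_exists (U : lmodType k) (S : set U) : is_subspace S ->
  exists T : set U, [/\ is_subspace T, forall x, T x -> S x -> x = 0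
    & forall x, exists s t, [/\ S s, T t & x = s + t]].
Proof.
move=> subS.
pose P (T : set U) := (forall a x y, T x -> T y -> T (a *: x + y)) /\
  (forall x, T x -> S x -> x = 0).
have [F FP Ftot|A [[Acl AS] Amax]] := @Zorn_bigcup U P.
  split=> [a x y [X FX Xx] [Y FY Yy]|x [X FX Xx] Sx]; last first.
    by have [_] := FP X FX; apply.
  have [XY|YX] := Ftot X Y FX FY.
    by exists Y => //; have [cl _] := FP Y FY; apply: cl => //; exact: XY.
  by exists X => //; have [cl _] := FP X FX; apply: cl => //; exact: YX.
have A0 : A 0.
  apply: contrapT => nA0.
  have AB : A `<` [set 0].
    split=> [y Ay|/(_ 0 erefl) //].
    by exfalso; apply: nA0; rewrite -[0](addNr y) -scaleN1r; exact: Acl.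
  apply: (Amax _ AB); split=> [a y z -> ->|y -> //] /=.
  by rewrite scaler0 addr0.
exists A; split=> // x; apply: contrapT => nx.
pose B : set U := [set y | exists c a, A a /\ y = c *: x + a].
have PB : P B.
  split=> [b _ _ [c [a [Aa ->]]] [c' [a' [Aa' ->]]]|_ [c [a [Aa ->]]] Scxa].
    exists (b * c + c'), (b *: a + a'); split; first exact: Acl.
    by rewrite scalerDr scalerA scalerDl addrACA.
  have [c0|c0] := eqVneq c 0.
    by move: Scxa; rewrite c0 scale0r add0r; exact: AS.
  exfalso; apply: nx; exists (c^-1 *: (c *: x + a)), (- c^-1 *: a + 0); split.
  - exact: is_subspaceZ.
  - exact: Acl.
  - by rewrite addr0 scalerDr scalerA mulVf // scale1r scaleNr addrK.
apply: (Amax B) => //; split=> [y Ay|/(_ x) BA].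
  by exists 0, y; rewrite scale0r add0r.
have Ax : A x by apply: BA; exists 1, 0; rewrite scale1r addr0.
by apply: nx; exists 0, x; rewrite add0r; split=> //; case: subS.
Qed.

Lemma linear_ginv (U V : lmodType k) (h : {linear U -> V}) :
  exists r : {linear V -> U}, forall x, h (r (h x)) = h x.
Proof.
have kerh : is_subspace [set x | h x = 0].
  split=> [|a x y /= hx hy]; first exact: linear0.
  by rewrite linearP hx hy scaler0 addr0.
have imh : is_subspace [set h x | x in [set: U]].
  split=> [|a _ _ [x _ <-] [y _ <-]]; first by exists 0; rewrite ?linear0.
  by exists (a *: x + y); rewrite ?linearP.
have [T1 [sT1 dT1 cT1]] := complement_exists kerh.
have [T2 [sT2 dT2 cT2]] := complement_exists imh.
pose Q (y : V) := [set x | T1 x /\ exists2 t, T2 t & y = h x + t].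
have Q_uniq y x x' : Q y x -> Q y x' -> x = x'.
  move=> [T1x [t T2t ->]] [T1x' [t' T2t' e]].
  apply/eqP; rewrite -subr_eq0; apply/eqP/dT1; first exact: is_subspaceB.
  rewrite /= linearB; apply: dT2; last by exists (x - x'); rewrite ?linearB.
  have -> : h x - h x' = t' - t.
    by apply/eqP; rewrite subr_eq addrAC eq_sym subr_eq addrC -e.
  exact: is_subspaceB.
have Q_ex y : exists x, Q y x.
  have [_ [t [[x _ <-] T2t ->]]] := cT2 y.
  have [s [x' [hs T1x' ex]]] := cT1 x.
  exists x'; split=> //; exists t => //.
  by rewrite ex linearD hs add0r.
pose r y := xget 0 (Q y).
have rP y : Q y (r y) by rewrite /r; apply: xgetPex; exact: Q_ex.
have rlin : linear r.
  move=> a x y; apply: (Q_uniq (a *: x + y)); first exact: rP.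
  have [T1x [t T2t ex]] := rP x; have [T1y [t' T2t' ey]] := rP y.
  split; first by case: sT1 => _; apply.
  exists (a *: t + t'); first by case: sT2 => _; apply.
  by rewrite linearP [in LHS]ex [in LHS]ey scalerDr addrACA.
pose rL := GRing.isLinear.Build k V U *:%R r rlin.
pose q : {linear V -> U} := HB.pack r rL.
exists q => x /=; have [_ [t T2t e]] := rP (h x).
suff t0 : t = 0 by rewrite [in RHS]e t0 addr0.
apply: dT2 => //; exists (x - r (h x)) => //.
by apply/eqP; rewrite linearB subr_eq addrC -e.
Qed.

End GeneralizedInverse.

Lemma tmapBl (k : fieldType) (U U' V V' : lmodType k)
    (f f' : {linear U -> U'}) (g : {linear V -> V'}) x :
  tmap (f \- f') g x = tmap f g x - tmap f' g x.
Proof.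
move: x; apply: (@tensor_linear_ext _ _ _ _ _ (tmap f g \- tmap f' g)) => u v.
by rewrite /= !tmapE linearBl.
Qed.

Section EqualizerTensor.
Variables (k : fieldType) (U V W : lmodType k) (f g : {linear U -> V}).
Local Notation valW :=
  (tmap (eqz_val : {linear equalizer f g -> U}) (@idfun W)).

Lemma eqz_projection : exists p : {linear U -> equalizer f g},
  cancel eqz_val p /\ forall W (y : U ⊗ W),
    tmap f idfun y = tmap g idfun y ->
    tmap (eqz_val : {linear equalizer f g -> U}) idfun (tmap p idfun y) = y.
Proof.
have [r rP] := linear_ginv (f \- g).
pose q : {linear U -> U} := idfun \- (r \o (f \- g)).
have fgq x : f (q x) = g (q x).
  apply/eqP; rewrite -subr_eq0; apply/eqP.
  have := rP x; rewrite /q /=; set z := r _ => e.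
  rewrite (linearB f) (linearB g) !opprB (addrC (g z)) addrACA (addrC (- f z)).
  by rewrite -e addrC -[f z - g z]opprB subrr.
exists (eqz_corestr fgq); split=> [x|W' y fgy].
  apply: eqz_val_inj; rewrite /= /q /= eqzP subrr linear0 subr0 //.
rewrite tmap_comp.
rewrite (@eq_tmap _ _ _ _ _ _ q _ idfun) //.
rewrite tmapBl tmap_id.
have -> : tmap (r \o (f \- g)) idfun y = tmap r idfun (tmap (f \- g) idfun y).
  by rewrite tmap_comp; apply: eq_tmap.
by rewrite tmapBl fgy subrr linear0 subr0.
Qed.

Lemma tmap_eqz_val_inj : injective valW.
Proof.
have [p [pK _]] := eqz_projection.
apply: (can_inj (g := tmap p (@idfun W))) => x.
rewrite tmap_comp -[RHS](tmap_id x); exact: eq_tmap.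
Qed.

Lemma tmap_eqz_val_surj (y : U ⊗ W) :
  tmap f idfun y = tmap g idfun y -> exists x, valW x = y.
Proof.
by have [p [_ pP]] := eqz_projection => /pP e; exists (tmap p idfun y).
Qed.

End EqualizerTensor.

Ltac tens_simpl := repeat progress
  (rewrite /= ?(tmapE, tassocE, tassocVE, tunitrE, tunitlE)).

Section TensorNaturality.
Variable k : fieldType.
Implicit Types U V W X : lmodType k.

Lemma tassoc_nat U U' V V' W W' (f : {linear U -> U'}) (g : {linear V -> V'})
    (h : {linear W -> W'}) x :
  tassoc (tmap (tmap f g) h x) = tmap f (tmap g h) (tassoc x).
Proof.
move: x; apply: (@tensor_linear_ext3 _ _ _ _ _
  (tassoc \o tmap (tmap f g) h) (tmap f (tmap g h) \o tassoc)) => u v w /=.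
by tens_simpl.
Qed.

Lemma tassocV_nat U U' V V' W W' (f : {linear U -> U'}) (g : {linear V -> V'})
    (h : {linear W -> W'}) x :
  tassocV (tmap f (tmap g h) x) = tmap (tmap f g) h (tassocV x).
Proof.
by apply: (can_inj (@tassocK _ _ _ _)); rewrite tassocVK tassoc_nat tassocVK.
Qed.

Lemma tassoc_pentagon U V W X (x : U ⊗ ((V ⊗ W) ⊗ X)) :
  tassoc (tmap tassocV idfun (tassocV x)) = tassocV (tmap idfun tassoc x).
Proof.
move: x; apply: (@tensor_linear_ext _ _ _ _
  (tassoc \o (tmap tassocV idfun \o tassocV))
  (tassocV \o tmap idfun tassoc)) => u y /=.
elim/tensor_ind: y => [|y z IHy IHz|y x].
- by rewrite !(tens0r, linear0).
- by rewrite tensDr !linearD /= IHy IHz.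
elim/tensor_ind: y => [|y z IHy IHz|v w].
- by rewrite !(tens0l, tens0r, linear0).
- by rewrite tensDl tensDr !linearD /= IHy IHz.
by tens_simpl.
Qed.

Lemma tassoc_pentagon2 U V W X (x : ((U ⊗ V) ⊗ W) ⊗ X) :
  tassoc (tassoc x) = tmap idfun tassoc (tassoc (tmap tassoc idfun x)).
Proof.
move: x; apply: (@tensor_linear_ext _ _ _ _ (tassoc \o tassoc)
  (tmap idfun tassoc \o (tassoc \o tmap tassoc idfun))) => y x /=.
elim/tensor_ind: y => [|y z IHy IHz|y w].
- by rewrite !(tens0l, linear0).
- by rewrite tensDl !linearD /= IHy IHz.
elim/tensor_ind: y => [|y z IHy IHz|u v].
- by rewrite !(tens0l, linear0).
- by rewrite !tensDl !linearD /= IHy IHz.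
by tens_simpl.
Qed.

Lemma tassoc_natl U U' V W (f : {linear U -> U'}) (x : (U ⊗ V) ⊗ W) :
  tassoc (tmap (tmap f idfun) idfun x) = tmap f idfun (tassoc x).
Proof. by rewrite tassoc_nat; apply: eq_tmap => // y; exact: tmap_id. Qed.

Lemma tassoc_natr U V W W' (f : {linear W -> W'}) (x : (U ⊗ V) ⊗ W) :
  tassoc (tmap idfun f x) = tmap idfun (tmap idfun f) (tassoc x).
Proof.
by rewrite -tassoc_nat; congr (tassoc _); apply: eq_tmap => // y;
   rewrite /= tmap_id.
Qed.

Lemma tunitl_assoc U V (x : (k^o ⊗ U) ⊗ V) :
  tunitl (tassoc x) = tmap tunitl idfun x.
Proof.
move: x; apply: (@tensor_linear_ext3 _ _ _ _ _ (tunitl \o tassoc)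
  (tmap tunitl idfun)) => a u v.
by tens_simpl; rewrite tensZl.
Qed.

Lemma tunitr_assoc U V (x : (U ⊗ V) ⊗ k^o) :
  tunitr x = tmap idfun tunitr (tassoc x).
Proof.
move: x; apply: (@tensor_linear_ext3 _ _ _ _ _ tunitr
  (tmap idfun tunitr \o tassoc)) => u v a.
by tens_simpl; rewrite tensZr.
Qed.

Lemma tunit_triangle U V (x : (U ⊗ k^o) ⊗ V) :
  tmap tunitr idfun x = tmap idfun tunitl (tassoc x).
Proof.
move: x; apply: (@tensor_linear_ext3 _ _ _ _ _ (tmap tunitr idfun)
  (tmap idfun tunitl \o tassoc)) => u a v.
by tens_simpl; rewrite tensZl tensZr.
Qed.

Lemma tunitr_nat U V (f : {linear U -> V}) x :
  f (tunitr x) = tunitr (tmap f idfun x).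
Proof.
move: x; apply: (@tensor_linear_ext _ _ _ _ (f \o tunitr)
  (tunitr \o tmap f idfun)) => u a.
by tens_simpl; rewrite linearZ_LR.
Qed.

End TensorNaturality.

Section Coalgebras.
Variable k : fieldType.

Record coalgebra := Coalgebra {
  coalg_sort :> lmodType k;
  comul : {linear coalg_sort -> coalg_sort ⊗ coalg_sort};
  counit : {linear coalg_sort -> k^o};
  comulA : tassoc \o tmap comul idfun \o comul =1 tmap idfun comul \o comul;
  comul_counitr : tunitr \o tmap idfun counit \o comul =1 id;
  comul_counitl : tunitl \o tmap counit idfun \o comul =1 id }.

Variable C : coalgebra.

Record rcomodule := RComodule {
  rcom_sort :> lmodType k;
  rcoact : {linear rcom_sort -> rcom_sort ⊗ C};
  rcoactA :
    tassoc \o tmap rcoact idfun \o rcoact =1 tmap idfun (comul C) \o rcoact;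
  rcoact_counit : tunitr \o tmap idfun (counit C) \o rcoact =1 id }.

Record lcomodule := LComodule {
  lcom_sort :> lmodType k;
  lcoact : {linear lcom_sort -> C ⊗ lcom_sort};
  lcoactA :
    tassoc \o tmap (comul C) idfun \o lcoact =1 tmap idfun lcoact \o lcoact;
  lcoact_counit : tunitl \o tmap (counit C) idfun \o lcoact =1 id }.

Record rcom_hom (M N : rcomodule) := RComHom {
  rcom_map :> {linear M -> N};
  rcom_mapP : tmap rcom_map idfun \o rcoact M =1 rcoact N \o rcom_map }.

Record lcom_hom (P Q : lcomodule) := LComHom {
  lcom_map :> {linear P -> Q};
  lcom_mapP : tmap idfun lcom_map \o lcoact P =1 lcoact Q \o lcom_map }.

Lemma rcom_hom_eq M N (f g : rcom_hom M N) : f =1 g -> f = g.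
Proof.
case: f g => [f fP] [g gP] /= /linear_eqP fg; rewrite {}fg in fP *.
by congr RComHom; exact: Prop_irrelevance.
Qed.

Lemma rcom_idP (M : rcomodule) :
  tmap idfun idfun \o rcoact M =1 rcoact M \o idfun.
Proof. by move=> x /=; rewrite tmap_id. Qed.

Definition rcom_id M : rcom_hom M M := @RComHom M M idfun (@rcom_idP M).

Lemma rcom_compP M N P (g : rcom_hom N P) (f : rcom_hom M N) :
  tmap (g \o f) idfun \o rcoact M =1 rcoact P \o (g \o f).
Proof.
move=> x /=; have /= := rcom_mapP f x => e; have /= <- := rcom_mapP g (f x).
by rewrite -e tmap_comp; apply: eq_tmap.
Qed.

Definition rcom_comp M N P (g : rcom_hom N P) (f : rcom_hom M N) :
    rcom_hom M P :=
  @RComHom M P (g \o f) (@rcom_compP M N P g f).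

Lemma lcom_idP (P : lcomodule) :
  tmap idfun idfun \o lcoact P =1 lcoact P \o idfun.
Proof. by move=> x /=; rewrite tmap_id. Qed.

Definition lcom_id P : lcom_hom P P := @LComHom P P idfun (@lcom_idP P).

Definition cotensor (N : rcomodule) (P : lcomodule) : lmodType k :=
  equalizer (tassoc \o tmap (rcoact N) (@idfun P)) (tmap (@idfun N) (lcoact P)).

Section CotensorMap.
Variables (N N' : rcomodule) (P P' : lcomodule).
Variables (f : rcom_hom N N') (g : lcom_hom P P').

Lemma cotensor_map_subproof (x : cotensor N P) :
  (tassoc \o tmap (rcoact N') (@idfun P')) ((tmap f g \o eqz_val) x) =
  tmap (@idfun N') (lcoact P') ((tmap f g \o eqz_val) x).
Proof.
have /= := eqzP x; set y := eqz_val x => e.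
transitivity (tassoc (tmap (tmap f idfun) g (tmap (rcoact N) idfun y))).
  rewrite /= !tmap_comp; congr (tassoc _); apply: eq_tmap => // n /=.
  exact/esym/(rcom_mapP f).
rewrite tassoc_nat e /= !tmap_comp; apply: eq_tmap => // p.
exact: (lcom_mapP g).
Qed.

Definition cotensor_map : cotensor N P -> cotensor N' P' :=
  eqz_corestr cotensor_map_subproof.
HB.instance Definition _ := GRing.Linear.on cotensor_map.

Lemma cotensor_mapE x : eqz_val (cotensor_map x) = tmap f g (eqz_val x).
Proof. by []. Qed.

End CotensorMap.

Section ComoduleTensor.
Variables (P : lcomodule) (W : lmodType k).

Definition lcoact_tensor : {linear P ⊗ W -> C ⊗ (P ⊗ W)} :=
  tassoc \o tmap (lcoact P) idfun.

Lemma lcoact_tensorA : tassoc \o tmap (comul C) idfun \o lcoact_tensor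
  =1 tmap idfun lcoact_tensor \o lcoact_tensor.
Proof.
move=> y /=; set t := tmap (lcoact P) idfun y.
rewrite -tassoc_natl tassoc_pentagon2.
have -> : tmap tassoc idfun (tmap (tmap (comul C) idfun) idfun t) =
          tmap (tmap idfun (lcoact P)) (@idfun W) t.
  rewrite /t !tmap_comp; apply: eq_tmap => // p; exact: (lcoactA p).
by rewrite tassoc_nat tmap_comp; apply: eq_tmap.
Qed.

Lemma lcoact_tensor_counit :
  tunitl \o tmap (counit C) idfun \o lcoact_tensor =1 id.
Proof.
move=> y /=; rewrite -tassoc_natl tunitl_assoc !tmap_comp -[RHS](tmap_id y).
by apply: eq_tmap => // p; exact: (lcoact_counit p).
Qed.

Definition lcom_tensor : lcomodule :=
  LComodule lcoact_tensorA lcoact_tensor_counit.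

End ComoduleTensor.

(* The canonical map (N □ P) ⊗ W -> N □ (P ⊗ W), bijective since k is a
   field. *)
Section CotensorTensor.
Variables (N : rcomodule) (P : lcomodule) (W : lmodType k).

Let e1 := tassoc \o tmap (rcoact N) (@idfun P).
Let e2 := tmap (@idfun N) (lcoact P).

Lemma tassoc_tmap_e1 (y : (N ⊗ P) ⊗ W) :
  tassoc (tmap (rcoact N) (@idfun (lcom_tensor P W)) (tassoc y)) =
  tmap idfun tassoc (tassoc (tmap e1 idfun y)).
Proof.
rewrite -tassoc_natl tassoc_pentagon2.
by congr (tmap _ _ (tassoc _)); rewrite tmap_comp; apply: eq_tmap.
Qed.

Lemma tassoc_tmap_e2 (y : (N ⊗ P) ⊗ W) :
  tmap (@idfun N) (lcoact (lcom_tensor P W)) (tassoc y) =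
  tmap idfun tassoc (tassoc (tmap e2 idfun y)).
Proof.
by rewrite tassoc_nat tmap_comp; apply: eq_tmap.
Qed.

Lemma cotensor_assoc_subproof (x : cotensor N P ⊗ W) :
  (tassoc \o tmap (rcoact N) (@idfun (lcom_tensor P W)))
    ((tassoc \o tmap eqz_val idfun) x) =
  tmap (@idfun N) (lcoact (lcom_tensor P W))
    ((tassoc \o tmap eqz_val idfun) x).
Proof.
rewrite [LHS]tassoc_tmap_e1 [RHS]tassoc_tmap_e2; congr (tmap _ _ (tassoc _)).
by rewrite !tmap_comp; apply: eq_tmap => // y; exact: (eqzP y).
Qed.

Definition cotensor_assoc : cotensor N P ⊗ W -> cotensor N (lcom_tensor P W) :=
  eqz_corestr cotensor_assoc_subproof.
HB.instance Definition _ := GRing.Linear.on cotensor_assoc.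

Lemma cotensor_assoc_bij : bijective cotensor_assoc.
Proof.
have inj : injective cotensor_assoc.
  move=> x y /(congr1 eqz_val) /= /(can_inj (@tassocK _ _ _ _)).
  exact: tmap_eqz_val_inj.
suff surj z : exists x, cotensor_assoc x == z.
  exists (fun z => xchoose (surj z)) => [x|z].
    by apply: inj; apply/eqP; exact: (xchooseP (surj (cotensor_assoc x))).
  exact/eqP/(xchooseP (surj z)).
have /= := eqzP z; set y := tassocV (eqz_val z).
rewrite -[eqz_val z]tassocVK -/y [LHS]tassoc_tmap_e1 [RHS]tassoc_tmap_e2.
move=> e.
have {}e : tmap e1 (@idfun W) y = tmap e2 idfun y.
  apply: (can_inj (@tassocK _ _ _ _)).
  have K : cancel (tmap (@idfun N) (@tassoc _ C P W)) (tmap idfun tassocV).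
    move=> t; rewrite tmap_comp -[RHS]tmap_id; apply: eq_tmap => //.
    exact: tassocK.
  exact: (can_inj K).
have [x ex] := tmap_eqz_val_surj e.
exists x; apply/eqP/eqz_val_inj.
rewrite /= ex; exact: tassocVK.
Qed.

End CotensorTensor.

End Coalgebras.

Arguments comul {k} c.
Arguments counit {k} c.
Arguments rcoact {k C} r.
Arguments lcoact {k C} l.

(* Transport along an equality of degrees, e.g. between X_(a(bc)) and
   X_((ab)c). *)
Definition transp (k : fieldType) (G : Type) (X : G -> lmodType k) a b
    (e : a = b) : {linear X a -> X b} :=
  match e in _ = c return {linear X a -> X c} with erefl => idfun end.

Section GroupCoalgebras.
Variables (k : fieldType) (G : groupType).

Record gcoalgebra := GCoalgebra {
  gcoalg_sort :> G -> lmodType k;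
  gcomul : forall a b,
    {linear gcoalg_sort (a * b)%g -> gcoalg_sort a ⊗ gcoalg_sort b};
  gcounit : {linear gcoalg_sort 1%g -> k^o};
  gcomulA : forall a b c,
    tassoc \o tmap (gcomul a b) idfun \o gcomul (a * b)%g c =1
    tmap idfun (gcomul b c) \o gcomul a (b * c)%g
      \o transp gcoalg_sort (esym (mulgA a b c));
  gcomul_counitr : forall a,
    tunitr \o tmap idfun gcounit \o gcomul a 1%g
      \o transp gcoalg_sort (esym (mulg1 a)) =1 id;
  gcomul_counitl : forall a,
    tunitl \o tmap gcounit idfun \o gcomul 1%g a
      \o transp gcoalg_sort (esym (mul1g a)) =1 id }.

Variable C : gcoalgebra.

Record gcomodule := GComodule {
  gcom_sort :> G -> lmodType k;
  gcoact : forall a b, {linear gcom_sort (a * b)%g -> gcom_sort a ⊗ C b};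
  gcoactA : forall a b c,
    tassoc \o tmap (gcoact a b) idfun \o gcoact (a * b)%g c =1
    tmap idfun (gcomul C b c) \o gcoact a (b * c)%g
      \o transp gcom_sort (esym (mulgA a b c));
  gcoact_counit : forall a,
    tunitr \o tmap idfun (gcounit C) \o gcoact a 1%g
      \o transp gcom_sort (esym (mulg1 a)) =1 id }.

Record gcom_hom (M N : gcomodule) := GComHom {
  gcom_map :> forall a, {linear M a -> N a};
  gcom_mapP : forall a b,
    tmap (gcom_map a) idfun \o gcoact M a b =1
    gcoact N a b \o gcom_map (a * b)%g }.

Lemma gcom_hom_eq M N (f g : gcom_hom M N) : (forall a, f a =1 g a) -> f = g.
Proof.
case: f g => [f fP] [g gP] /= fg.
have {}fg : f = g by apply: functional_extensionality_dep => a; exact: linear_eqP (fg a).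
by rewrite {}fg in fP *; congr GComHom; exact: Prop_irrelevance.
Qed.

Lemma gcom_idP (M : gcomodule) a b :
  tmap idfun idfun \o gcoact M a b =1 gcoact M a b \o idfun.
Proof. by move=> x /=; rewrite tmap_id. Qed.

Definition gcom_id M : gcom_hom M M :=
  @GComHom M M (fun=> idfun) (@gcom_idP M).

Lemma gcom_compP M N P (g : gcom_hom N P) (f : gcom_hom M N) a b :
  tmap (g a \o f a) idfun \o gcoact M a b =1
  gcoact P a b \o (g (a * b)%g \o f (a * b)%g).
Proof.
move=> x /=; have /= := gcom_mapP f x => e; have /= <- := gcom_mapP g (f _ x).
by rewrite -e tmap_comp; apply: eq_tmap.
Qed.

Definition gcom_comp M N P (g : gcom_hom N P) (f : gcom_hom M N) :
    gcom_hom M P :=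
  @GComHom M P (fun a => g a \o f a) (@gcom_compP M N P g f).

(* [gcomul_at] and [gcoact_at] are the structure maps preceded by a transport to
   degree ab. *)
Definition gcomul_at a b c (e : c = (a * b)%g) : {linear C c -> C a ⊗ C b} :=
  gcomul C a b \o transp C e.

Definition gcoact_at (M : gcomodule) a b c (e : c = (a * b)%g) :
    {linear M c -> M a ⊗ C b} :=
  gcoact M a b \o transp M e.

Lemma gcomul_atA a b c d e f (hd : d = (a * b)%g) (hf : f = (d * c)%g)
    (he : e = (b * c)%g) (hf' : f = (a * e)%g) x :
  tassoc (tmap (gcomul_at hd) idfun (gcomul_at hf x)) =
  tmap idfun (gcomul_at he) (gcomul_at hf' x).
Proof.
subst d e f; rewrite (Prop_irrelevance hf' (esym (mulgA a b c))).
have := gcomulA x; rewrite /= => e; rewrite /gcomul_at /=.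
have -> (U V W : lmodType k) (f : {linear U -> V}) :
  tmap (f \o idfun) (@idfun W) =1 tmap f idfun by move=> y; apply: eq_tmap.
rewrite {}e; apply: eq_tmap => //.
Qed.

Lemma gcoact_atA (M : gcomodule) a b c d e f (hd : d = (a * b)%g)
    (hf : f = (d * c)%g) (he : e = (b * c)%g) (hf' : f = (a * e)%g) x :
  tassoc (tmap (gcoact_at M hd) idfun (gcoact_at M hf x)) =
  tmap idfun (gcomul_at he) (gcoact_at M hf' x).
Proof.
subst d e f; rewrite (Prop_irrelevance hf' (esym (mulgA a b c))).
have := gcoactA x; rewrite /= => e; rewrite /gcoact_at /gcomul_at /=.
have -> (U V W : lmodType k) (f : {linear U -> V}) :
  tmap (f \o idfun) (@idfun W) =1 tmap f idfun by move=> y; apply: eq_tmap.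
rewrite {}e; apply: eq_tmap => //.
Qed.

Lemma gcomul_at_counitr a (e : a = (a * 1)%g) (x : C a) :
  tunitr (tmap idfun (gcounit C) (gcomul_at e x)) = x.
Proof. by rewrite (Prop_irrelevance e (esym (mulg1 a))); exact: gcomul_counitr. Qed.

Lemma gcomul_at_counitl a (e : a = (1 * a)%g) (x : C a) :
  tunitl (tmap (gcounit C) idfun (gcomul_at e x)) = x.
Proof. by rewrite (Prop_irrelevance e (esym (mul1g a))); exact: gcomul_counitl. Qed.

Lemma gcoact_at_counit (M : gcomodule) a (e : a = (a * 1)%g) (x : M a) :
  tunitr (tmap idfun (gcounit C) (gcoact_at M e x)) = x.
Proof. by rewrite (Prop_irrelevance e (esym (mulg1 a))); exact: gcoact_counit. Qed.

Definition gcoalg1 : coalgebra k :=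
  @Coalgebra k (C 1%g) (gcomul_at (esym (mul1g 1%g))) (gcounit C)
    (gcomul_atA _ _ _ _) (gcomul_at_counitr _) (gcomul_at_counitl _).

Definition gcoalg_right (a : G) : rcomodule gcoalg1 :=
  @RComodule k gcoalg1 (C a) (gcomul_at (esym (mulg1 a)))
    (gcomul_atA _ _ _ _) (gcomul_at_counitr _).

Definition gcoalg_left (a : G) : lcomodule gcoalg1 :=
  @LComodule k gcoalg1 (C a) (gcomul_at (esym (mul1g a)))
    (gcomul_atA _ _ _ _) (gcomul_at_counitl _).

Lemma gcomul_corestr_subproof a b (x : C (a * b)%g) :
  (tassoc \o tmap (rcoact (gcoalg_right a)) (@idfun (gcoalg_left b)))
    (gcomul C a b x) =
  tmap (@idfun (gcoalg_right a)) (lcoact (gcoalg_left b)) (gcomul C a b x).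
Proof. exact: (gcomul_atA (esym (mulg1 a)) erefl (esym (mul1g b)) erefl). Qed.

(* The corestriction C_(ab) -> C_a □ C_b of the comultiplication. *)
Definition gcomul_corestr (a b : G) :
    {linear C (a * b)%g -> cotensor (gcoalg_right a) (gcoalg_left b)} :=
  eqz_corestr (@gcomul_corestr_subproof a b).

Definition strong := forall a b, injective (gcomul C a b).

Lemma gcomul_leftP (a b : G) :
  tmap idfun (gcomul C a b) \o lcoact (gcoalg_left (a * b)%g) =1
  lcoact (lcom_tensor (gcoalg_left a) (C b)) \o gcomul C a b.
Proof.
move=> x; symmetry.
exact: (gcomul_atA (esym (mul1g a)) erefl erefl (esym (mul1g _))).
Qed.

Definition gcomul_left (a b : G) :
    lcom_hom (gcoalg_left (a * b)%g) (lcom_tensor (gcoalg_left a) (C b)) :=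
  @LComHom k gcoalg1 (gcoalg_left (a * b)%g) (lcom_tensor (gcoalg_left a) (C b))
    (gcomul C a b) (@gcomul_leftP a b).

End GroupCoalgebras.

Record category := Category {
  obj :> Type;
  mor : obj -> obj -> Type;
  cat_id : forall X, mor X X;
  cat_comp : forall X Y Z, mor Y Z -> mor X Y -> mor X Z;
  cat_comp1m : forall X Y (f : mor X Y), cat_comp (cat_id Y) f = f;
  cat_compm1 : forall X Y (f : mor X Y), cat_comp f (cat_id X) = f;
  cat_compA : forall X Y Z T (h : mor Z T) (g : mor Y Z) (f : mor X Y),
    cat_comp h (cat_comp g f) = cat_comp (cat_comp h g) f }.

Definition is_iso (A : category) (X Y : A) (f : mor X Y) : Prop :=
  exists g : mor Y X, cat_comp g f = cat_id X /\ cat_comp f g = cat_id Y.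

Record functor (A B : category) := Functor {
  fobj :> A -> B;
  fmor : forall X Y : A, mor X Y -> mor (fobj X) (fobj Y);
  fmor_id : forall X : A, fmor (cat_id X) = cat_id (fobj X);
  fmor_comp : forall (X Y Z : A) (g : mor Y Z) (f : mor X Y),
    fmor (cat_comp g f) = cat_comp (fmor g) (fmor f) }.

Record adjunction (A B : category) (L : functor A B) (R : functor B A) :=
  Adjunction {
    adj_unit : forall X : A, mor X (R (L X));
    adj_counit : forall Y : B, mor (L (R Y)) Y;
    adj_unit_nat : forall (X X' : A) (f : mor X X'),
      cat_comp (adj_unit X') f = cat_comp (fmor R (fmor L f)) (adj_unit X);
    adj_counit_nat : forall (Y Y' : B) (f : mor Y Y'),
      cat_comp (adj_counit Y') (fmor L (fmor R f)) = cat_comp f (adj_counit Y);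
    adj_triangleL : forall X : A,
      cat_comp (adj_counit (L X)) (fmor L (adj_unit X)) = cat_id (L X);
    adj_triangleR : forall Y : B,
      cat_comp (fmor R (adj_counit Y)) (adj_unit (R Y)) = cat_id (R Y) }.

(* The functors of an adjoint pair are inverse equivalences: the unit and the
   counit are natural isomorphisms. *)
Definition inverse_equivalences (A B : category) (L : functor A B)
    (R : functor B A) (adj : adjunction L R) : Prop :=
  (forall X : A, is_iso (adj_unit adj X)) /\
  (forall Y : B, is_iso (adj_counit adj Y)).

Definition rcom_cat (k : fieldType) (C : coalgebra k) : category.
Proof.
refine (@Category (rcomodule C) (@rcom_hom k C) (@rcom_id k C) (@rcom_comp k C)
  _ _ _).
- by move=> X Y f; exact: rcom_hom_eq.
- by move=> X Y f; exact: rcom_hom_eq.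
- by move=> X Y Z T h g f; exact: rcom_hom_eq.
Defined.

Definition gcom_cat (k : fieldType) (G : groupType) (C : gcoalgebra k G) :
  category.
Proof.
refine (@Category (gcomodule C) (@gcom_hom k G C) (@gcom_id k G C)
  (@gcom_comp k G C) _ _ _).
- by move=> X Y f; exact: gcom_hom_eq.
- by move=> X Y f; exact: gcom_hom_eq.
- by move=> X Y Z T h g f; exact: gcom_hom_eq.
Defined.

Section InducedAdjunction.
Variables (k : fieldType) (G : groupType) (C : gcoalgebra k G).

(* F : M |-> M_e *)
Definition F_obj (M : gcomodule C) : rcomodule (gcoalg1 C) :=
  @RComodule k (gcoalg1 C) (M 1%g) (gcoact_at M (esym (mul1g 1%g)))
    (gcoact_atA _ _ _ _) (gcoact_at_counit _).

Lemma gcom_map_at (M N : gcomodule C) (f : gcom_hom M N) a b c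
    (e : c = (a * b)%g) x :
  tmap (f a) idfun (gcoact_at M e x) = gcoact_at N e (f c x).
Proof. by subst c; exact: (gcom_mapP f). Qed.

Definition F_mor (M N : gcomodule C) (f : gcom_hom M N) :
    rcom_hom (F_obj M) (F_obj N) :=
  @RComHom k (gcoalg1 C) (F_obj M) (F_obj N) (f 1%g) (gcom_map_at f _).

Definition F_functor : functor (gcom_cat C) (rcom_cat (gcoalg1 C)).
Proof.
refine (@Functor (gcom_cat C) (rcom_cat (gcoalg1 C)) F_obj F_mor _ _).
- by move=> M; exact: rcom_hom_eq.
- by move=> M N P g f; exact: rcom_hom_eq.
Defined.

(* G : N |-> (N □ C_a)_a *)
Section InducedObj.
Variable N : rcomodule (gcoalg1 C).

Definition ind_sort (a : G) : lmodType k := cotensor N (gcoalg_left C a).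

(* N □ C_(ab) -> N □ (C_a ⊗ C_b) ~= (N □ C_a) ⊗ C_b *)
Definition ind_coact (a b : G) :
    {linear ind_sort (a * b)%g -> ind_sort a ⊗ C b} :=
  linv (cotensor_assoc_bij N (gcoalg_left C a) (C b))
    \o cotensor_map (rcom_id N) (gcomul_left C a b).

Lemma ind_coactE a b x :
  tmap eqz_val idfun (ind_coact a b x) =
  tassocV (tmap (@idfun N) (gcomul C a b) (eqz_val x)).
Proof.
apply: (can_inj (@tassocK _ _ _ _)); rewrite tassocVK.
have := linvK (cotensor_assoc_bij N (gcoalg_left C a) (C b))
   (cotensor_map (rcom_id N) (gcomul_left C a b) x).
by move=> /(congr1 eqz_val).
Qed.

Lemma ind_transpE a b (e : a = b) (x : ind_sort a) :
  eqz_val (transp ind_sort e x) = tmap idfun (transp C e) (eqz_val x).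
Proof. by subst b; rewrite /= tmap_id. Qed.

Lemma ind_coact_atE a b c (e : c = (a * b)%g) (x : ind_sort c) :
  tmap eqz_val idfun (ind_coact a b (transp ind_sort e x)) =
  tassocV (tmap (@idfun N) (gcomul_at C e) (eqz_val x)).
Proof.
by rewrite ind_coactE ind_transpE tmap_comp.
Qed.

Lemma ind_coactA a b c :
  tassoc \o tmap (ind_coact a b) idfun \o ind_coact (a * b)%g c =1
  tmap idfun (gcomul C b c) \o ind_coact a (b * c)%g
      \o transp ind_sort (esym (mulgA a b c)).
Proof.
move=> x /=.
apply: (@tmap_eqz_val_inj _ _ _ (C b ⊗ C c)).
have -> (y : (ind_sort a ⊗ C b) ⊗ C c) : tmap eqz_val idfun (tassoc y) =
   tassoc (tmap (tmap eqz_val (@idfun (C b))) (@idfun (C c)) y).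
  by rewrite tassoc_natl.
rewrite tmap_comp.
transitivity (tassoc (tmap (tassocV \o tmap (@idfun N) (gcomul C a b))
    (@idfun (C c)) (tmap eqz_val idfun (ind_coact (a * b)%g c x)))).
  rewrite tmap_comp; congr (tassoc _); apply: eq_tmap => // y.
  exact: ind_coactE.
rewrite ind_coactE.
have -> z : tmap (tassocV \o tmap (@idfun N) (gcomul C a b)) (@idfun (C c)) z
   = tmap tassocV idfun (tmap (tmap (@idfun N) (gcomul C a b)) (@idfun (C c)) z).
  by rewrite tmap_comp; apply: eq_tmap.
rewrite -tassocV_nat tassoc_pentagon.
have -> z : tmap eqz_val (@idfun _) (tmap (@idfun (ind_sort a)) (gcomul C b c) z)
   = tmap idfun (gcomul C b c) (tmap eqz_val idfun z).
  by rewrite !tmap_comp; apply: eq_tmap.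
rewrite ind_coact_atE.
have <- z : tassocV (tmap (@idfun N) (tmap idfun (gcomul C b c)) z) =
   tmap (@idfun (N ⊗ C a)) (gcomul C b c) (tassocV z).
  by rewrite tassocV_nat; apply: eq_tmap => // y; exact: tmap_id.
rewrite !tmap_comp; congr (tassocV _); apply: eq_tmap => // y.
exact: (gcomulA y).
Qed.

Lemma ind_coact_counit a :
  tunitr \o tmap idfun (gcounit C) \o ind_coact a 1%g
      \o transp ind_sort (esym (mulg1 a)) =1 id.
Proof.
move=> x; apply: eqz_val_inj => /=.
rewrite tunitr_nat.
have -> z : tmap eqz_val (@idfun _) (tmap (@idfun (ind_sort a)) (gcounit C) z)
   = tmap idfun (gcounit C) (tmap eqz_val idfun z).
  by rewrite !tmap_comp; apply: eq_tmap.
rewrite ind_coact_atE tunitr_assoc.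
have -> z : tassoc (tmap (@idfun (N ⊗ C a)) (gcounit C) (tassocV z)) =
  tmap (@idfun N) (tmap (@idfun (C a)) (gcounit C)) z.
  by rewrite tassoc_natr tassocVK.
rewrite !tmap_comp -[RHS]tmap_id; apply: eq_tmap => // y.
exact: gcomul_at_counitr.
Qed.

Definition ind_obj : gcomodule C :=
  @GComodule k G C ind_sort ind_coact ind_coactA ind_coact_counit.

End InducedObj.

Section InducedMor.
Variables (N N' : rcomodule (gcoalg1 C)) (f : rcom_hom N N').

Definition ind_map (a : G) : {linear ind_obj N a -> ind_obj N' a} :=
  cotensor_map f (lcom_id (gcoalg_left C a)).

Lemma ind_mapP a b : tmap (ind_map a) idfun \o ind_coact N a b =1
  ind_coact N' a b \o ind_map (a * b)%g.
Proof.
move=> x; apply: (@tmap_eqz_val_inj _ _ _ (C b)).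
transitivity (tmap (tmap f idfun) idfun
   (tmap eqz_val (@idfun (C b)) (ind_coact N a b x))).
  by rewrite [RHS]tmap_comp [LHS]tmap_comp; apply: eq_tmap.
rewrite !ind_coactE -tassocV_nat /= !tmap_comp; congr (tassocV _).
by apply: eq_tmap => // y /=; rewrite tmap_id.
Qed.

Definition ind_mor : gcom_hom (ind_obj N) (ind_obj N') :=
  @GComHom k G C (ind_obj N) (ind_obj N') ind_map ind_mapP.

End InducedMor.

Definition G_functor : functor (rcom_cat (gcoalg1 C)) (gcom_cat C).
Proof.
refine (@Functor (rcom_cat (gcoalg1 C)) (gcom_cat C) ind_obj ind_mor _ _).
- move=> N; apply: gcom_hom_eq => a x; apply: eqz_val_inj => /=.
  exact: tmap_id.
- move=> N P Q g f; apply: gcom_hom_eq => a x; apply: eqz_val_inj => /=.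
  by rewrite tmap_comp; apply: eq_tmap.
Defined.

Section Unit.
Variable M : gcomodule C.

Lemma unit_subproof a (x : M a) :
  (tassoc \o tmap (rcoact (F_obj M)) (@idfun (gcoalg_left C a)))
    (gcoact_at M (esym (mul1g a)) x) =
  tmap (@idfun (F_obj M)) (lcoact (gcoalg_left C a))
    (gcoact_at M (esym (mul1g a)) x).
Proof. exact: (gcoact_atA (esym (mul1g 1%g))). Qed.

(* The corestriction M_a -> M_e □ C_a of the coaction of M. *)
Definition unit_map a : {linear M a -> ind_obj (F_obj M) a} :=
  eqz_corestr (@unit_subproof a).

Lemma unit_mapP a b : tmap (unit_map a) idfun \o gcoact M a b =1
  gcoact (ind_obj (F_obj M)) a b \o unit_map (a * b)%g.
Proof.
move=> x /=; apply: (@tmap_eqz_val_inj _ _ _ (C b)).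
rewrite ind_coactE /= tmap_comp.
apply: (can_inj (@tassocK _ _ _ _)); rewrite tassocVK.
rewrite -[RHS](gcoact_atA (esym (mul1g a)) erefl erefl).
by congr (tassoc _); apply: eq_tmap.
Qed.

Definition unit_mor : gcom_hom M (ind_obj (F_obj M)) :=
  @GComHom k G C M (ind_obj (F_obj M)) unit_map unit_mapP.

End Unit.

Section Counit.
Variable N : rcomodule (gcoalg1 C).

Definition counit_map : {linear F_obj (ind_obj N) -> N} :=
  tunitr \o tmap idfun (gcounit C) \o eqz_val.

Lemma counit_mapP :
  tmap counit_map idfun \o rcoact (F_obj (ind_obj N)) =1 rcoact N \o counit_map.
Proof.
move=> x.
transitivity (eqz_val x).
  transitivity (tmap (tunitr \o tmap (@idfun N) (gcounit C)) (@idfun (C 1%g))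
    (tmap eqz_val idfun (rcoact (F_obj (ind_obj N)) x))).
    by rewrite tmap_comp; apply: eq_tmap.
  rewrite ind_coact_atE.
  have -> z : tmap (tunitr \o tmap (@idfun N) (gcounit C)) (@idfun (C 1%g)) z =
    tmap tunitr idfun (tmap (tmap (@idfun N) (gcounit C)) idfun z).
    by rewrite tmap_comp; apply: eq_tmap.
  rewrite tunit_triangle tassoc_nat tassocVK !tmap_comp -[RHS]tmap_id.
  by apply: eq_tmap => // y; exact: gcomul_at_counitl.
rewrite /= tunitr_nat tunitr_assoc.
have -> z : tmap (rcoact N) (@idfun _) (tmap (@idfun N) (gcounit C) z) =
  tmap idfun (gcounit C) (tmap (rcoact N) idfun z).
  by rewrite !tmap_comp; apply: eq_tmap.
rewrite tassoc_natr; have /= -> := eqzP x.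
rewrite !tmap_comp -[LHS]tmap_id; apply: eq_tmap => // y.
exact/esym/gcomul_at_counitr.
Qed.

Definition counit_mor : rcom_hom (F_obj (ind_obj N)) N :=
  @RComHom k (gcoalg1 C) (F_obj (ind_obj N)) N counit_map counit_mapP.

End Counit.

Definition FG_adjunction : adjunction F_functor G_functor.
Proof.
refine (@Adjunction _ _ F_functor G_functor unit_mor counit_mor _ _ _ _).
- move=> M M' f; apply: gcom_hom_eq => a x; apply: eqz_val_inj => /=.
  exact/esym/(gcom_map_at f).
- move=> N N' f; apply: rcom_hom_eq => x /=.
  rewrite tunitr_nat !tmap_comp; congr (tunitr _); exact: eq_tmap.
- move=> M; apply: rcom_hom_eq => x /=.
  exact: gcoact_at_counit.
- move=> N; apply: gcom_hom_eq => a x; apply: eqz_val_inj.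
  rewrite /= .
  transitivity (tmap (tunitr \o tmap (@idfun N) (gcounit C)) (@idfun (C a))
     (tmap eqz_val idfun (gcoact_at (ind_obj N) (esym (mul1g a)) x))).
    by rewrite tmap_comp; apply: eq_tmap.
  rewrite ind_coact_atE.
  have -> z : tmap (tunitr \o tmap (@idfun N) (gcounit C)) (@idfun (C a)) z =
    tmap tunitr idfun (tmap (tmap (@idfun N) (gcounit C)) idfun z).
    by rewrite tmap_comp; apply: eq_tmap.
  rewrite tunit_triangle tassoc_nat tassocVK !tmap_comp -[RHS]tmap_id.
  by apply: eq_tmap => // y; exact: gcomul_at_counitl.
Defined.

End InducedAdjunction.

(* Main.v *)
Require Import Defs.
From mathcomp Require Import all_boot all_algebra.

Set Implicit Arguments.
Unset Strict Implicit.
Unset Printing Implicit Defensive.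

Import GRing.Theory.
Local Open Scope ring_scope.

(** Everything reduces to degree e. The counit N □ C_e -> N is bijective for
    any group coalgebra, its inverse being the coaction of N
    ([counit_map_bij]). By a triangle identity the unit is then bijective in
    degree e for every M ([unit_map1_bij]).

    The use of strongness is to propagate this to all degrees
    ([strong_bijective]). For a G-comodule M, coassociativity identifies
      M_a --rho--> M_e ⊗ C_a --rho ⊗ C_a--> M_a ⊗ C_(a^-1) ⊗ C_a
    with
      M_a --rho--> M_a ⊗ C_e --M_a ⊗ Delta--> M_a ⊗ C_(a^-1) ⊗ C_a,
    and the latter is injective when Delta_(a^-1, a) is, because of the counit
    and because tensoring over a field preserves injections. So M_a embeds
    into M_e ⊗ C_a, and a comodule map with zero kernel and cokernel in degree e
    has zero kernel and cokernel in degree a. The unit is thus an isomorphism.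

    Conversely, the comultiplications turn b |-> C_(ab) into a G-comodule
    ([shift_comod]), and the degree b part of its unit is the corestriction
    C_(ab) -> C_a □ C_b of Delta_(a, b), up to the identification of C_(ae) with
    C_a. Finally Delta_(a, b) is its corestriction followed by an inclusion, so
    it is injective as soon as its corestriction is. *)

(** * Linear algebra of tensor products *)

Lemma inj_surj_bij (T U : choiceType) (f : T -> U) :
  injective f -> (forall y, exists x, f x = y) -> bijective f.
Proof.
move=> finj fsurj.
have fs y : exists x, f x == y by have [x <-] := fsurj y; exists x.
have fK : cancel (fun y => xchoose (fs y)) f.
  by move=> y; apply/eqP/(xchooseP (fs y)).
by exists (fun y => xchoose (fs y)) => // x; apply: finj; rewrite fK.
Qed.

Section TensorInjective.
Variables (k : fieldType) (U V W W' : lmodType k) (f : {linear U -> V}).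

(** Over a field an injection has a linear retraction, and a surjection a linear
    section; these survive tensoring. *)
Lemma tmapl_inj : injective f -> injective (tmap f (@idfun W)).
Proof.
have [r rP] := linear_ginv f; move=> finj.
apply: (can_inj (g := tmap r (@idfun W))) => x.
by rewrite tmap_comp -[RHS]tmap_id; apply: eq_tmap => // y; apply: finj; exact: rP.
Qed.

Lemma tmapr_inj : injective f -> injective (tmap (@idfun W) f).
Proof.
have [r rP] := linear_ginv f; move=> finj.
apply: (can_inj (g := tmap (@idfun W) r)) => x.
by rewrite tmap_comp -[RHS]tmap_id; apply: eq_tmap => // y; apply: finj; exact: rP.
Qed.

Lemma tmapl_surj : (forall y, exists x, f x = y) ->
  forall y, exists x, tmap f (@idfun W) x = y.
Proof.
have [r rP] := linear_ginv f; move=> fsurj y; exists (tmap r idfun y).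
rewrite tmap_comp -[RHS]tmap_id; apply: eq_tmap => // v.
by have [u <-] := fsurj v; exact: rP.
Qed.

Lemma tmapl_eq0 (g : {linear W -> W'}) :
  (forall u, f u = 0) -> forall x, tmap f g x = 0.
Proof.
move=> f0; elim/tensor_ind => [|x y x0 y0|u w]; first exact: linear0.
- by rewrite linearD /= x0 y0 addr0.
- by rewrite tmapE f0 tens0l.
Qed.

End TensorInjective.

(** * Isomorphisms of comodules *)

Lemma rcom_hom_iso (k : fieldType) (C : coalgebra k) (M N : rcom_cat C)
    (f : mor M N) : bijective (rcom_map f) -> is_iso f.
Proof.
move=> fbij.
have invP : tmap (linv fbij) (@idfun C) \o rcoact N =1 rcoact M \o linv fbij.
  move=> y; rewrite -[y in LHS](linvK fbij) /=.
  have /= <- := rcom_mapP f (linv fbij y).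
  rewrite tmap_comp -[RHS]tmap_id; apply: eq_tmap => // x; exact: linvKV.
exists (@RComHom k C N M (linv fbij) invP); split; apply: rcom_hom_eq => x.
- exact: linvKV.
- exact: linvK.
Qed.

Section GroupComodules.
Variables (k : fieldType) (G : groupType) (C : gcoalgebra k G).

Lemma gcom_hom_iso (M N : gcom_cat C) (f : mor M N) :
  (forall a, bijective (gcom_map f a)) -> is_iso f.
Proof.
move=> fbij.
have invP a b : tmap (linv (fbij a)) idfun \o gcoact N a b =1
    gcoact M a b \o linv (fbij (a * b)%g).
  move=> y; rewrite -[y in LHS](linvK (fbij _)) /=.
  have /= <- := gcom_mapP f (linv (fbij (a * b)%g) y).
  rewrite tmap_comp -[RHS]tmap_id; apply: eq_tmap => // x; exact: linvKV.
exists (@GComHom k G C N M (fun a => linv (fbij a)) invP).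
by split; apply: gcom_hom_eq => a x; [exact: linvKV|exact: linvK].
Qed.

Lemma gcom_iso_bij (M N : gcom_cat C) (f : mor M N) :
  is_iso f -> forall a, bijective (gcom_map f a).
Proof.
move=> [g [gf fg]] a; exists (gcom_map g a) => x.
- exact: (congr1 (fun h : gcom_hom M M => h a x) gf).
- exact: (congr1 (fun h : gcom_hom N N => h a x) fg).
Qed.

Lemma transp_bij (X : G -> lmodType k) a b (e : a = b) :
  bijective (transp X e).
Proof. by subst b; exists id. Qed.

(** * Degree e *)

(** The inverse of the counit sends n to its coaction, which lies in N □ C_e by
    coassociativity. *)
Lemma counit_map_bij (N : rcomodule (gcoalg1 C)) : bijective (counit_map N).
Proof.
pose h := eqz_corestr ((rcoactA (r := N)) : forall x,
  (tassoc \o tmap (rcoact N) (@idfun (gcoalg_left C 1%g))) (rcoact N x) =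
  tmap (@idfun N) (lcoact (gcoalg_left C 1%g)) (rcoact N x)).
exists h => [x|n]; last exact: (rcoact_counit n).
apply: eqz_val_inj; rewrite /= tunitr_nat tunitr_assoc.
have -> z : tmap (rcoact N) (@idfun _) (tmap (@idfun N) (gcounit C) z) =
  tmap idfun (gcounit C) (tmap (rcoact N) idfun z).
  by rewrite !tmap_comp; apply: eq_tmap.
rewrite tassoc_natr; have /= -> := eqzP x.
rewrite !tmap_comp -[RHS]tmap_id; apply: eq_tmap => // y.
exact: gcomul_at_counitr.
Qed.

(** A triangle identity makes the unit in degree e a right inverse of the
    bijective counit at M_e. *)
Lemma unit_map1_bij (M : gcomodule C) : bijective (unit_map M 1%g).
Proof.
have triangle : cancel (unit_map M 1%g) (counit_map (F_obj M)).
  exact: gcoact_at_counit.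
apply: (bij_can_bij (counit_map_bij (F_obj M))) => x.
by apply: (bij_inj (counit_map_bij (F_obj M))); rewrite triangle.
Qed.

(** * From degree e to all degrees *)

Section Strong.
Hypothesis strongC : strong C.

Lemma gcomul_at_inj a b c (e : c = (a * b)%g) : injective (gcomul_at C e).
Proof. exact: inj_comp (@strongC a b) (bij_inj (transp_bij _ e)). Qed.

(** The coassociativity square described at the top, with a linear map p applied
    to the factor M_a. With p the identity it shows that M_a embeds into
    M_e ⊗ C_a; with p a projection along a subspace it detects whether an
    element lies in that subspace, which gives surjectivity without forming
    a cokernel comodule. *)
Lemma strong_separates (M : gcomodule C) (a : G) (V : lmodType k)
    (p : {linear M a -> V}) (x : M a) :
  tmap (tmap p idfun) idfun
    (tmap (gcoact_at M (esym (mulgV a))) idfun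
      (gcoact_at M (esym (mul1g a)) x)) = 0 ->
  p x = 0.
Proof.
move=> px0.
have : tmap p idfun (gcoact_at M (esym (mulg1 a)) x) = 0.
  apply: (tmapr_inj (gcomul_at_inj (e := esym (mulVg a)))).
  rewrite linear0 tmap_comp.
  transitivity (tmap p idfun (tmap idfun (gcomul_at C (esym (mulVg a)))
    (gcoact_at M (esym (mulg1 a)) x))); first by rewrite tmap_comp; apply: eq_tmap.
  rewrite -(gcoact_atA (esym (mulgV a)) (esym (mul1g a))).
  by rewrite -tassoc_natl px0 linear0.
move=> /(congr1 (fun z => tunitr (tmap idfun (gcounit C) z))).
rewrite !linear0 => <-; rewrite -[x in LHS](gcoact_at_counit (esym (mulg1 a))).
by rewrite tunitr_nat !tmap_comp; congr (tunitr _); apply: eq_tmap.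
Qed.

Variables (M N : gcomodule C) (f : gcom_hom M N).

Lemma strong_injective a : injective (f 1%g) -> injective (f a).
Proof.
move=> f1 x y fxy; apply/eqP; rewrite -subr_eq0; apply/eqP.
apply: (@strong_separates M a _ idfun).
have -> : gcoact_at M (esym (mul1g a)) (x - y) = 0.
  apply: (tmapl_inj f1); rewrite linear0 (gcom_map_at f).
  by rewrite linearB fxy subrr linear0.
by rewrite !linear0.
Qed.

Lemma strong_surjective a :
  (forall y, exists x, f 1%g x = y) -> forall y, exists x, f a x = y.
Proof.
move=> f1 y; have [r rP] := linear_ginv (f a).
(* p is the projection of N_a whose kernel is the image of f *)
pose p : {linear N a -> N a} := idfun \- (f a \o r).
have pf z : p (f a z) = 0 by rewrite /p /= rP subrr.
suff : p y = 0 by move/eqP; rewrite subr_eq0 => /eqP e; exists (r y).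
apply: strong_separates.
have [z <-] := tmapl_surj f1 (gcoact_at N (esym (mul1g a)) y).
rewrite !tmap_comp; apply: tmapl_eq0 => m.
transitivity (tmap p idfun (gcoact_at N (esym (mulgV a)) (f 1%g m))) => //.
by rewrite -(gcom_map_at f) tmap_comp; exact: tmapl_eq0.
Qed.

Lemma strong_bijective a : bijective (f 1%g) -> bijective (f a).
Proof.
move=> f1; apply: inj_surj_bij.
  exact: strong_injective (bij_inj f1).
by apply: strong_surjective => y; have [g _ gK] := f1; exists (g y).
Qed.

End Strong.

(** * The comodule b |-> C_(ab) *)

Lemma gcomul_at_transp b c d e (h : d = e) (h' : e = (b * c)%g)
    (h'' : d = (b * c)%g) x : gcomul_at C h' (transp C h x) = gcomul_at C h'' x.
Proof. by subst d; rewrite (eq_irrelevance h' h''). Qed.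

Lemma gcomul_at_transpl b b' c d (e : b = b') (h : d = (b * c)%g)
    (h' : d = (b' * c)%g) x :
  tmap (transp C e) idfun (gcomul_at C h x) = gcomul_at C h' x.
Proof. by subst b'; rewrite (eq_irrelevance h' h) /= tmap_id. Qed.

Section Shift.
Variable a : G.

Definition shift_sort (b : G) : lmodType k := C (a * b)%g.

Definition shift_coact (b c : G) :
    {linear shift_sort (b * c)%g -> shift_sort b ⊗ C c} :=
  gcomul_at C (mulgA a b c).

Lemma shift_coact_transp b c d e (h : d = e) (h' : e = (b * c)%g)
    (h'' : (a * d)%g = (a * b * c)%g) (x : shift_sort d) :
  shift_coact b c (transp shift_sort h' (transp shift_sort h x)) =
  gcomul_at C h'' x.
Proof. by subst d e; rewrite (eq_irrelevance h'' (mulgA a b c)). Qed.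

Lemma shift_coactA b c d :
  tassoc \o tmap (shift_coact b c) idfun \o shift_coact (b * c)%g d =1
  tmap idfun (gcomul C c d) \o shift_coact b (c * d)%g
      \o transp shift_sort (esym (mulgA b c d)).
Proof.
move=> x; have e : (a * (b * c * d) = a * b * (c * d))%g by rewrite !mulgA.
transitivity (tmap idfun (gcomul_at C erefl) (gcomul_at C e x)).
  exact: gcomul_atA.
rewrite -(shift_coact_transp (esym (mulgA b c d)) erefl e).
exact: eq_tmap.
Qed.

Lemma shift_coact_counit b :
  tunitr \o tmap idfun (gcounit C) \o shift_coact b 1%g
      \o transp shift_sort (esym (mulg1 b)) =1 id.
Proof.
move=> x; have e : (a * b = a * b * 1)%g by rewrite mulg1.
rewrite -[RHS](gcomul_at_counitr e) -(shift_coact_transp (esym (mulg1 b)) erefl).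
by [].
Qed.

Definition shift_comod : gcomodule C :=
  @GComodule k G C shift_sort shift_coact shift_coactA shift_coact_counit.

Lemma shift_coact_at b c d (e : d = (b * c)%g) (h : (a * d)%g = (a * b * c)%g)
    (x : shift_sort d) :
  gcoact_at shift_comod e x = gcomul_at C h x.
Proof. by subst d; rewrite (eq_irrelevance h (mulgA a b c)). Qed.

Lemma shift_degree1P : tmap (transp C (esym (mulg1 a))) idfun
    \o rcoact (gcoalg_right C a) =1
  rcoact (F_obj shift_comod) \o transp C (esym (mulg1 a)).
Proof.
move=> x /=; have h : (a * 1 = a * 1 * 1)%g by rewrite !mulg1.
have h' : (a = a * 1 * 1)%g by rewrite !mulg1.
transitivity (gcomul_at C h' x); first exact: gcomul_at_transpl.
rewrite -(gcomul_at_transp (esym (mulg1 a)) h); exact/esym/shift_coact_at.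
Qed.

(** C_a and the degree e part C_(ae) of the shifted comodule are different types,
    so their identification has to be carried along. *)
Definition shift_degree1 : rcom_hom (gcoalg_right C a) (F_obj shift_comod) :=
  @RComHom k (gcoalg1 C) (gcoalg_right C a) (F_obj shift_comod)
    (transp C (esym (mulg1 a))) shift_degree1P.

Lemma unit_shift b x : unit_map shift_comod b x =
  cotensor_map shift_degree1 (lcom_id (gcoalg_left C b)) (gcomul_corestr C a b x).
Proof.
apply: eqz_val_inj => /=; have h : (a * b = a * 1 * b)%g by rewrite mulg1.
transitivity (gcomul_at C h x); first exact: shift_coact_at.
exact/esym/(gcomul_at_transpl (esym (mulg1 a)) erefl).
Qed.

(** The corestriction is the unit followed by the inverse of the identification
    of C_a □ C_b with C_(ae) □ C_b. *)
Lemma gcomul_corestr_bij b :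
  bijective (unit_map shift_comod b) -> bijective (gcomul_corestr C a b).
Proof.
move=> ubij.
have sinj : injective
    (cotensor_map shift_degree1 (lcom_id (gcoalg_left C b))).
  move=> x y /(congr1 eqz_val) /tmapl_inj xy; apply/eqz_val_inj/xy.
  exact: bij_inj (transp_bij _ _).
apply: inj_surj_bij => [x y xy|y].
  by apply: (bij_inj ubij); rewrite !unit_shift xy.
have [v _ vK] := ubij.
exists (v (cotensor_map shift_degree1 (lcom_id (gcoalg_left C b)) y)).
by apply: sinj; rewrite -unit_shift vK.
Qed.

End Shift.

End GroupComodules.

Theorem theorem1p7 (k : fieldType) (G : groupType) (C : gcoalgebra k G) :
  [<-> strong C;
       inverse_equivalences (FG_adjunction C);
       forall a b : G, bijective (gcomul_corestr C a b)].
Proof.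
tfae.
- move=> strongC; split=> [M|N]; last exact/rcom_hom_iso/counit_map_bij.
  apply: gcom_hom_iso => a.
  exact: (strong_bijective strongC (f := unit_mor M) a (unit_map1_bij M)).
- move=> [unit_iso _] a b; apply: gcomul_corestr_bij.
  exact: (gcom_iso_bij (unit_iso (shift_comod C a))).
- by move=> bij a b x y xy; apply: (bij_inj (bij a b)); apply: eqz_val_inj.
Qed.
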